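(* Let $\chi$ be a finite alphabet and let $(X_n)_{n\ge1}$ be an i.i.d. source with values in $\chi$, of entropy $H$. For every one-to-one code sequence $\gamma:\chi^{*}\to\{0,1\}^{*}$, $$\liminf_{n\to\infty}\frac1n\sum_{\boldsymbol{x}\in\chi^{n}}\|\gamma(\boldsymbol{x})\|\cdot p(\boldsymbol{x})\ \geq\ H.$$
   Context: For a finite set $\chi$, $\chi^{n}$ is the set of sequences of length $n$ of elements of $\chi$, and $\chi^{*}=\bigcup_{n=0}^{\infty}\chi^{n}$; likewise $\{0,1\}^{*}$ is the set of all finite binary strings. $\|w\|$ denotes the length of a finite sequence $w$. A (binary) one-to-one code sequence (also called faithful-code sequence) is any function $\gamma:\chi^{*}\to\{0,1\}^{*}$ such that, for every integer $n$, the restriction of $\gamma$ to $\chi^{n}$ is injective. No prefix-freeness is required, and $\gamma$ need not be injective on all of $\chi^{*}$. An i.i.d. source is a sequence $(X_n)_{n\ge1}$ of independent, identically distributed random variables with values in $\chi$. For $\boldsymbol{x}=(x_1,\ldots,x_n)\in\chi^{n}$, $p(\boldsymbol{x})=\Pr(X_1=x_1,\ldots,X_n=x_n)=\prod_{i=1}^{n}\Pr(X_1=x_i)$. The entropy of the source is $H=H(X_1)=-\sum_{a\in\chi}\Pr(X_1=a)\log_2\Pr(X_1=a)$, with the convention $0\log_2 0=0$. *)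

(* Defs.v *)
From HB Require Import structures.
From mathcomp Require Import all_boot all_order all_algebra.
From mathcomp Require Import all_classical all_reals all_analysis.

Set Implicit Arguments.
Unset Strict Implicit.
Unset Printing Implicit Defensive.

Import Order.TTheory GRing.Theory Num.Theory.
Import numFieldNormedType.Exports.

Local Open Scope classical_set_scope.
Local Open Scope ring_scope.

Definition one_to_one_code (chi : finType) (gamma : seq chi -> seq bool) : Prop :=
  forall n : nat,
    {in [pred w : seq chi | size w == n] &, injective gamma}.

Section Source.
Context (d : measure_display) (T : measurableType d) (R : realType).
Variables (P : probability T R) (chi : finType).

(* The finite type chi carries the discrete sigma-algebra, so the events are
   the preimages of arbitrary B : set chi. *)
Definition random_variables (X : nat -> T -> chi) : Prop :=
  forall (n : nat) (B : set chi), measurable (X n @^-1` B).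

Definition mutually_independent (X : nat -> T -> chi) : Prop :=
  forall (J : seq nat) (B : nat -> set chi), uniq J ->
    fine (P (\bigcap_(i in [set` J]) (X i @^-1` B i))) =
    \prod_(i <- J) fine (P (X i @^-1` B i)).

Definition identically_distributed (X : nat -> T -> chi) : Prop :=
  forall (m n : nat) (B : set chi), P (X m @^-1` B) = P (X n @^-1` B).

(* Times are numbered from 0: X n is the (n+1)-st letter of the source. *)
Definition iid_source (X : nat -> T -> chi) : Prop :=
  [/\ random_variables X, mutually_independent X & identically_distributed X].

Definition word_prob (X : nat -> T -> chi) (n : nat) (x : n.-tuple chi) : R :=
  fine (P [set t | forall i : 'I_n, X i t = tnth x i]).

Definition log2 (x : R) : R := ln x / ln 2.

(* The convention 0 log2 0 = 0 holds because ln is total (and 0 * _ = 0). *)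
Definition entropy (Y : T -> chi) : R :=
  - \sum_(a : chi) fine (P (Y @^-1` [set a])) *
                   log2 (fine (P (Y @^-1` [set a]))).

Definition mean_code_length (X : nat -> T -> chi)
    (gamma : seq chi -> seq bool) (n : nat) : R :=
  \sum_(x : n.-tuple chi) (size (gamma x))%:R * word_prob X x.

End Source.

(* Main.v *)
(** Fix a rate s > ln 2.  An injective map l into binary words satisfies the
    Kraft-type bound  \sum_i e^(- s |l i|) <= 1 / (1 - 2 e^(-s)),  because at
    most 2^k indices get a word of length k.  Gibbs' inequality against these
    weights gives  n H ln 2 <= s E|gamma(X_1..X_n)| + C(s)  with C(s)
    independent of n; divide by n, let n tend to infinity, then let s decrease
    to ln 2. *)
Require Import Defs.
From mathcomp Require Import all_boot all_order all_algebra.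
From mathcomp Require Import all_classical all_reals all_analysis.
From mathcomp Require Import ring lra.

Set Implicit Arguments.
Unset Strict Implicit.
Unset Printing Implicit Defensive.

Import Order.TTheory GRing.Theory Num.Theory.
Import numFieldNormedType.Exports.

Local Open Scope ring_scope.

(** * Kraft-type bound for injective codes *)

Lemma card_size_le (I : finType) (f : I -> seq bool) (k : nat) :
  injective f -> (#|[pred i | size (f i) == k]| <= 2 ^ k)%N.
Proof.
move=> f_inj; rewrite -card_bool -card_tuple.
(* The default tuple is never taken on the indices counted, whose words have length exactly [k]. *)
apply: (@leq_card_in _ _ (fun i => insubd (nseq_tuple k false) (f i))).
move=> i j; rewrite !inE => si sj /(congr1 val).
by rewrite !val_insubd si sj => /f_inj.
Qed.

Lemma sum_geometric_le (R : realFieldType) (x : R) (n : nat) :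
  0 <= x < 1 -> \sum_(i < n) x ^+ i <= (1 - x)^-1.
Proof.
move=> /andP[x_ge0 x_lt1]; have x1_gt0 : 0 < 1 - x by rewrite subr_gt0.
rewrite -[leRHS]mul1r ler_pdivlMr // mulrC.
have -> : (1 - x) * (\sum_(i < n) x ^+ i) = 1 - x ^+ n.
  by rewrite -[1 - x ^+ n]opprB subrX1 -mulNr opprB.
by rewrite gerBl exprn_ge0.
Qed.

(** Grouped by word length, at most [2 ^ k] terms equal [r ^+ k], so a geometric series of ratio
    [2 * r] dominates. *)
Lemma sum_exprn_size_le (R : realFieldType) (I : finType) (f : I -> seq bool)
    (r : R) :
  injective f -> 0 <= r -> 2 * r < 1 ->
  \sum_i r ^+ size (f i) <= (1 - 2 * r)^-1.
Proof.
move=> f_inj r_ge0 r_lt.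
have size_lt i : (size (f i) < (\max_j size (f j)).+1)%N.
  by rewrite ltnS (leq_bigmax i).
rewrite (partition_big (fun i => Ordinal (size_lt i)) xpredT) //=.
have r2_ge0 : 0 <= 2 * r by rewrite mulr_ge0.
apply: le_trans (sum_geometric_le (\max_j size (f j)).+1 _); last first.
  by rewrite r2_ge0.
apply: ler_sum => k _.
rewrite (eq_bigr (fun=> r ^+ k)) => [|i /eqP <- //].
rewrite sumr_const -[leLHS]mulr_natl exprMn ler_wpM2r ?exprn_ge0 //.
by rewrite -natrX ler_nat (leq_trans _ (card_size_le k f_inj)).
Qed.

(** * Gibbs' inequality and the one-shot bound *)

Lemma ln_le_subr1 (R : realType) (x : R) : 0 < x -> ln x <= x - 1.
Proof.
move=> x_gt0; rewrite -{1}[x](subrK 1) addrC le_ln1Dx //.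
by rewrite ltrBrDr addNr.
Qed.

(** If a factor is 0 both sides vanish, so letters of probability zero are covered. *)
Lemma mul_lnM (R : realType) (x y : R) : 0 <= x -> 0 <= y ->
  x * y * ln (x * y) = y * (x * ln x) + x * (y * ln y).
Proof.
rewrite !le0r => /orP[/eqP->|x_gt0]; first by rewrite !mul0r mulr0 addr0.
move=> /orP[/eqP->|y_gt0]; first by rewrite !(mul0r, mulr0) addr0.
by rewrite lnM ?posrE //; ring.
Qed.

(** Apply [ln z <= z - 1] to [z = q i / (Q * p i)] and average over [p]. The weights [q] are not
    normalized, whence the term [ln Q]. *)
Lemma gibbs (R : realType) (I : finType) (p q : I -> R) :
  (forall i, 0 <= p i) -> \sum_i p i = 1 -> (forall i, 0 < q i) ->
  \sum_i p i * ln (q i) <= \sum_i p i * ln (p i) + ln (\sum_i q i).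
Proof.
move=> p_ge0 p_sum q_gt0; set Q := \sum_i q i.
have Q_gt0 : 0 < Q.
  rewrite lt0r sumr_ge0 ?andbT => [|i _]; last exact: ltW.
  (* [Q = 0] would leave no index at all, against [p_sum]. *)
  apply/negP => /eqP; rewrite /Q => /psumr_eq0P q0.
  have : \sum_i p i = 0.
    apply: big1 => i _; have := q_gt0 i.
    by rewrite q0 ?ltxx // => j _; exact: ltW.
  by rewrite p_sum => /eqP; rewrite oner_eq0.
rewrite -[ln Q]mul1r -p_sum mulr_suml -big_split /= -subr_ge0 -sumrB.
(* Writing 0 as this sum lets the inequality be proved term by term. *)
have pqQ0 : \sum_i (p i - q i / Q) = 0.
  by rewrite sumrB p_sum -mulr_suml divff ?subrr // gt_eqF.
rewrite -[leLHS]pqQ0; apply: ler_sum => i _; have := p_ge0 i; rewrite le0r => /orP[/eqP->|pi_gt0].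
  by rewrite !mul0r addr0 subrr sub0r oppr_le0 divr_ge0 ?ltW.
have qp_gt0 : 0 < q i / (Q * p i) by rewrite divr_gt0 ?mulr_gt0.
have := ler_wpM2l (ltW pi_gt0) (ln_le_subr1 qp_gt0).
rewrite ln_div ?posrE ?mulr_gt0 // lnM ?posrE //.
have -> : p i * (q i / (Q * p i) - 1) = q i / Q - p i.
  by field; rewrite !gt_eqF.
lra.
Qed.

(** Gibbs with [q i = expR (- s) ^+ size (f i)], whose logarithm is [- s * size (f i)]; [ln 2 < s]
    makes the Kraft-type sum bounded. *)
Lemma entropy_le_mean_size (R : realType) (I : finType) (p : I -> R)
    (f : I -> seq bool) (s : R) :
  (forall i, 0 <= p i) -> \sum_i p i = 1 -> injective f -> ln 2 < s ->
  - \sum_i p i * ln (p i) <=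
    s * (\sum_i (size (f i))%:R * p i) + ln (1 - 2 * expR (- s))^-1.
Proof.
move=> p_ge0 p_sum f_inj s_gt.
have r_lt : 2 * expR (- s) < 1.
  rewrite -[X in X * _](@lnK R 2) ?posrE // -expRD expR_lt1.
  by rewrite subr_lt0.
have := gibbs p_ge0 p_sum (fun i => exprn_gt0 (size (f i)) (expR_gt0 (- s))).
rewrite (eq_bigr (fun i => - (s * ((size (f i))%:R * p i)))); last first.
  move=> i _; rewrite lnXn ?expR_gt0 // expRK -mulr_natl; ring.
rewrite sumrN -mulr_sumr => gibbs_le.
have : ln (\sum_i expR (- s) ^+ size (f i)) <= ln (1 - 2 * expR (- s))^-1.
  have sum_le := sum_exprn_size_le f_inj (expR_ge0 (- s)) r_lt.
  (* An index is needed for the sum inside [ln] to be positive. *)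
  have [i _|I0] := pickP (@predT I).
    rewrite ler_ln ?posrE ?invr_gt0 ?subr_gt0 //.
    apply: lt_le_trans (exprn_gt0 (size (f i)) (expR_gt0 (- s))) _.
    by rewrite (bigD1 i) //= lerDl sumr_ge0 // => j _; rewrite exprn_ge0 ?expR_ge0.
  by move/eqP: p_sum; rewrite big1 ?(eq_sym 0) ?oner_eq0 // => i; have := I0 i.
lra.
Qed.

(** * Additivity of entropy for product distributions *)

Lemma sum_tupleS (V : nmodType) (chi : finType) (n : nat)
    (F : n.+1.-tuple chi -> V) :
  \sum_x F x = \sum_a \sum_(y : n.-tuple chi) F [tuple of a :: y].
Proof.
rewrite pair_big (reindex (fun u : chi * n.-tuple chi => [tuple of u.1 :: u.2])).
  by [].
exists (fun x => (thead x, [tuple of behead x])) => [[a y] _|x _] /=.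
  by congr pair; apply/val_inj.
by rewrite -tuple_eta.
Qed.

Section ProductDistribution.
Context (R : realType) (chi : finType) (p : chi -> R).
Hypotheses (p_ge0 : forall a, 0 <= p a) (p_sum : \sum_a p a = 1).

Lemma sum_prod_tuple (n : nat) :
  \sum_(x : n.-tuple chi) \prod_(a <- x) p a = 1.
Proof.
elim: n => [|n IHn].
  rewrite (eq_bigr (fun=> 1)) => [|x _]; last by rewrite tuple0 big_nil.
  by rewrite sumr_const card_tuple.
rewrite sum_tupleS -[RHS]p_sum; apply: eq_bigr => a _.
under eq_bigr do rewrite big_cons.
by rewrite -mulr_sumr IHn mulr1.
Qed.

Lemma sum_mul_ln_prod_tuple (n : nat) :
  \sum_(x : n.-tuple chi) (\prod_(a <- x) p a) * ln (\prod_(a <- x) p a) =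
    n%:R * \sum_a p a * ln (p a).
Proof.
elim: n => [|n IHn].
  by rewrite mul0r big1 // => x _; rewrite tuple0 big_nil ln1 mulr0.
rewrite sum_tupleS -natr1 mulrDl mul1r -IHn; set S := \sum_(x : _.-tuple _) _.
(* Spreads [S] over the first letter, to match the sum over [a :: y]. *)
have -> : S = \sum_a p a * S by rewrite -mulr_suml p_sum mul1r.
rewrite addrC -big_split; apply: eq_bigr => a _ /=.
under eq_bigr do rewrite big_cons mul_lnM ?prodr_ge0 //.
by rewrite big_split /= -mulr_suml sum_prod_tuple mul1r mulr_sumr.
Qed.

End ProductDistribution.

(** * Word probabilities of an i.i.d. source *)

Section Source.
Context (d : measure_display) (T : measurableType d) (R : realType).
Context (P : probability T R) (chi : finType) (X : nat -> T -> chi).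
Hypothesis X_iid : iid_source P X.

Let p (a : chi) : R := fine (P (X 0%N @^-1` [set a])%classic).

Lemma sum_letter_prob : \sum_a p a = 1.
Proof.
have [mX _ _] := X_iid.
apply: EFin_inj; rewrite -sumEFin.
under eq_bigr do rewrite fineK ?fin_num_measure //.
rewrite -(@probability_setT _ _ _ P).
have -> : [set: T]%classic = (\bigcup_a X 0%N @^-1` [set a])%classic.
  by apply/seteqP; split=> // t _; exists (X 0%N t).
have chi_fin : finite_set [set: chi]%classic by exact: finite_finset.
rewrite measure_fin_bigcup //=; last by move=> a b _ _ [t [/= <- <-]].
rewrite fsbig_finite //=; apply/perm_big/uniq_perm.
- exact: index_enum_uniq.
- exact: finmap.fset_uniq.
- by move=> a; rewrite in_fset_set // in_setT; exact: mem_index_enum.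
Qed.

Lemma word_prob_prod (n : nat) (x : n.-tuple chi) :
  word_prob P X x = \prod_(a <- x) p a.
Proof.
have [_ X_indep X_id] := X_iid.
(* Independence takes events indexed by all of [nat]; for [i < n] this set is the singleton of the
   [i]-th letter of [x]. *)
pose B i := [set a | onth x i = Some a]%classic.
have := X_indep (iota 0 n) B (iota_uniq 0 n).
have -> : (\bigcap_(i in [set` iota 0 n]) (X i @^-1` B i))%classic =
          [set t | forall i : 'I_n, X i t = tnth x i]%classic.
  apply/seteqP; split=> t /= xt i.
    apply/esym/(iffRL (tnth_onth _ _ _)); apply: xt.
    by rewrite /= mem_iota /=.
  rewrite /= mem_iota /= add0n => i_lt.
  exact: (iffLR (tnth_onth _ _ _) (esym (xt (Ordinal i_lt)))).
rewrite /word_prob => ->; rewrite big_tuple -{1}[n]subn0 big_mkord.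
apply: eq_bigr => i _; rewrite /p (X_id i 0%N); congr (fine (P _)).
apply/seteqP; split=> t /=; first by move/(iffRL (tnth_onth _ _ _)).
by move=> Xt; exact: (iffLR (tnth_onth _ _ _) (esym Xt)).
Qed.

Lemma entropyE : entropy P (X 0%N) = - (\sum_a p a * ln (p a)) / ln 2.
Proof.
rewrite /entropy mulNr mulr_suml.
by congr (- _); apply: eq_bigr => a _; rewrite /log2 mulrA.
Qed.

(** The one-shot bound on words of length [n], where [gamma] is injective; the factor [ln 2]
    converts bits to nats. *)
Lemma entropy_le_mean_code_length (gamma : seq chi -> seq bool) (s : R)
    (n : nat) :
  one_to_one_code gamma -> ln 2 < s ->
  n%:R * (entropy P (X 0%N) * ln 2) <=
    s * mean_code_length P X gamma n + ln (1 - 2 * expR (- s))^-1.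
Proof.
move=> gamma_inj s_gt; have p_ge0 a : 0 <= p a by exact: fine_ge0.
have f_inj : injective (fun x : n.-tuple chi => gamma x).
  by move=> x y /gamma_inj xy; apply/val_inj/xy; rewrite inE size_tuple.
have w_ge0 (x : n.-tuple chi) : 0 <= \prod_(a <- x) p a by rewrite prodr_ge0.
have := entropy_le_mean_size w_ge0 (sum_prod_tuple sum_letter_prob n) f_inj s_gt.
rewrite sum_mul_ln_prod_tuple //; last exact: sum_letter_prob.
rewrite entropyE divfK ?mulrN; last by rewrite gt_eqF // ln_gt0 // ltr1n.
suff -> : mean_code_length P X gamma n =
          \sum_(x : n.-tuple chi) (size (gamma x))%:R * \prod_(a <- x) p a by [].
by apply: eq_bigr => x _; rewrite word_prob_prod.
Qed.

End Source.

(** * Passage to the limit *)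

Lemma limn_einf_ge (R : realType) (u : (\bar R)^nat) (l : \bar R) :
  (\forall n \near \oo%classic, l <= u n)%E -> (l <= limn_einf u)%E.
Proof.
case=> N _ u_ge; rewrite limn_einf_lim; apply: lime_ge; first exact: is_cvg_einfs.
exists N => // n /= N_le; apply: le_ereal_inf_tmp => _ [k /= n_le <-].
by apply: u_ge => /=; exact: leq_trans n_le.
Qed.

Theorem theorem4 (R : realType) (d : measure_display) (T : measurableType d)
    (P : probability T R) (chi : finType) (X : nat -> T -> chi)
    (gamma : seq chi -> seq bool) :
  iid_source P X ->
  one_to_one_code gamma ->
  ((entropy P (X 0%N))%:E <=
     limn_einf (fun n : nat => ((n%:R)^-1 * mean_code_length P X gamma n)%R%:E))%E.
Proof.
move=> X_iid gamma_inj; set H := entropy P (X 0%N).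
apply/lee_addgt0Pr => e e_gt0; rewrite -leeBlDr //= -EFinB.
apply: limn_einf_ge.
have ln2_gt0 : 0 < ln 2 :> R by rewrite ln_gt0 // ltr1n.
(* The rate is [s = t * ln 2], with [t] so near 1 that [(t - 1) * H] costs at most half of [e]; the
   [+ 1] keeps the denominator positive. *)
pose t := 1 + e / 2 / (`|H| + 1).
have H1_gt0 : 0 < `|H| + 1 by rewrite ltr_wpDl.
have t_gt1 : 1 < t by rewrite ltrDl !divr_gt0.
have tH_le : (t - 1) * H <= e / 2.
  rewrite [t]addrC addrK mulrAC ler_pdivrMr // ler_pM2l ?divr_gt0 //.
  by rewrite (le_trans (ler_norm H)) // lerDl.
have s_gt : ln 2 < t * ln 2 by rewrite ltr_pMl.
pose C := ln (1 - 2 * expR (- (t * ln 2)))^-1 / ln 2.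
near=> n.
have n_gt0 : 0 < n%:R :> R by rewrite ltr0n; near: n; exact: nbhs_infty_gt.
(* The other half of [e] absorbs the constant [C], for [n] large. *)
have C_le : C <= n%:R * (e / 2).
  rewrite -ler_pdivrMr ?divr_gt0 //; near: n; exact: nbhs_infty_ger.
have := entropy_le_mean_code_length X_iid n gamma_inj s_gt.
rewrite -/H lee_fin ler_pdivlMl // => le_mean.
have {}le_mean : n%:R * H <= t * mean_code_length P X gamma n + C.
  rewrite -(ler_pM2r ln2_gt0) mulrDl divfK ?gt_eqF //.
  by move: le_mean; congr (_ <= _); ring.
set M := mean_code_length P X gamma n in le_mean *.
have t_gt0 : 0 < t by exact: lt_trans t_gt1.
(* After scaling by [t]: [n * t * (H - e) <= n * H - n * e / 2 <= n * H - C <= t * M]. *)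
rewrite -(ler_pM2l t_gt0).
have tH_n := ler_wpM2l (ltW n_gt0) tH_le.
have te_n : n%:R * e <= n%:R * (t * e) by rewrite ler_pM2l // ler_peMl // ltW.
lra.
Unshelve. all: by end_near.
Qed.
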